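(* Let $G,H$ be finite alphabets, $S\subseteq G^n$, and $f:S\to H$ a non-constant partial function. Then $\mathrm{fbs}(f)\le\sqrt{n\cdot\mathrm{bs}(f)}$.
   Context: For $x\in S$, $x_i$ is its $i$-th letter. A set $B\subseteq[n]$ is a sensitive block of $x\in S$ if there is $y\in S$ with $f(y)\neq f(x)$ and $B=\{i:x_i\neq y_i\}$; let $\mathcal B_x$ be their set. $\mathrm{bs}(f,x)$ is the maximum number of pairwise disjoint sensitive blocks of $x$, and $\mathrm{bs}(f)=\max_{x\in S}\mathrm{bs}(f,x)$. $\mathrm{fbs}(f,x)=\max\sum_{B\in\mathcal B_x}w(B)$ over $w:\mathcal B_x\to[0,1]$ with $\sum_{B\in\mathcal B_x:i\in B}w(B)\le1$ for every $i\in[n]$, and $\mathrm{fbs}(f)=\max_{x\in S}\mathrm{fbs}(f,x)$. *)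

(* Defs.v *)
From HB Require Import structures.
From mathcomp Require Import all_boot all_order all_algebra.
From mathcomp Require Import all_classical all_reals.
From mathcomp Require Import topology normedtype derive.

Set Implicit Arguments.
Unset Strict Implicit.
Unset Printing Implicit Defensive.

Import Order.TTheory GRing.Theory Num.Theory.
Import numFieldNormedType.Exports.

Local Open Scope ring_scope.

Section BlockSensitivity.

Variable R : realType.
(* The partial function f is defined exactly on S: its domain is the subtype
   {x | x \in S}, so quantifying over that type is quantifying over S. *)
Variables (G H : finType) (n : nat) (S : {set {ffun 'I_n -> G}}).
Variable f : {x : {ffun 'I_n -> G} | x \in S} -> H.

Implicit Types x y : {x : {ffun 'I_n -> G} | x \in S}.

Definition nonconstant := exists x y, f x <> f y.

Definition diff_set x y : {set 'I_n} := [set i | val x i != val y i].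

Definition sensitive_blocks x : {set {set 'I_n}} :=
  [set B | [exists y, (f y != f x) && (B == diff_set x y)]].

Definition bs_at x : nat :=
  (\max_(P : {set {set 'I_n}} | (P \subset sensitive_blocks x) && finset.trivIset P)
     #|P|)%N.

Definition bs : nat := (\max_x bs_at x)%N.

(* Weights are total functions on sets of indices; only their values on
   sensitive blocks of x are constrained and used. *)
Definition fractional_packing x (w : {set 'I_n} -> R) : Prop :=
  (forall B, B \in sensitive_blocks x -> 0 <= w B <= 1) /\
  (forall i, \sum_(B in sensitive_blocks x | i \in B) w B <= 1).

Definition packing_value x (w : {set 'I_n} -> R) : R :=
  \sum_(B in sensitive_blocks x) w B.

Definition fbs_at x : R :=
  sup [set v | exists2 w, fractional_packing x w & v = packing_value x w]%classic.

Let N := #|{: {set 'I_n}}|.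
Let weight_of (v : 'rV[R]_N) (B : {set 'I_n}) : R := v ord0 (enum_rank B).

Let continuous_sum_weight (P : pred {set 'I_n}) :
  continuous (fun v : 'rV[R]_N => \sum_(B | P B) weight_of v B).
Proof.
apply: continuous_big => [|B _]; first exact: (@add_continuous R^o).
exact: coord_continuous.
Qed.

(* The supremum in the definition of fbs_at is a maximum. *)
Lemma fbs_at_max x : exists2 w, fractional_packing x w &
  packing_value x w = fbs_at x /\
  forall w', fractional_packing x w' -> packing_value x w' <= fbs_at x.
Proof.
pose box := [set v : 'rV[R]_N | forall j, `[0 : R, 1]%classic (v ord0 j)]%classic.
pose C i := [set v | \sum_(B in sensitive_blocks x | i \in B) weight_of v B <= 1]%classic.
pose K := (box `&` \bigcap_(i in setT) C i)%classic.
have Kcpt : compact K.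
  apply: compact_closedI; last first.
    apply: closed_bigI => i _.
    exact: (continuous_closedP _).1 (@continuous_sum_weight _) _ (@closed_le R 1).
  apply: (@rV_compact R N (fun=> `[0, 1]%classic)) => j.
  exact: segment_compact.
have K0 : (K !=set0)%classic.
  exists 0; split=> [j|i _] /=; first by rewrite mxE in_itv /= lexx ler01.
  by rewrite /C /= big1 // => B _; rewrite /weight_of mxE.
have packK v : K v -> fractional_packing x (weight_of v).
  case=> vbox vC; split=> [B _|i]; last exact: (vC i).
  by have := vbox (enum_rank B); rewrite /= in_itv.
have Kpack w : fractional_packing x w -> exists2 v, K v &
    packing_value x (weight_of v) = packing_value x w.
  case=> w01 wi.
  pose v : 'rV[R]_N := \row_j
    (if enum_val j \in sensitive_blocks x then w (enum_val j) else 0).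
  have vE B : B \in sensitive_blocks x -> weight_of v B = w B.
    by move=> xB; rewrite /weight_of mxE enum_rankK xB.
  exists v; last by apply: eq_bigr.
  split=> [j|i _] /=.
    rewrite mxE in_itv /=; case: ifPn => [/w01 //|_]; by rewrite lexx ler01.
  rewrite /C /= (eq_bigr w) // => B /andP[xB _]; exact: vE.
have [v /set_mem Kv vmax] := compact_EVT_max K0 Kcpt
  (continuous_subspaceT (@continuous_sum_weight (mem (sensitive_blocks x)))).
pose A := [set r | exists2 w, fractional_packing x w & r = packing_value x w]%classic.
have Av : A (packing_value x (weight_of v)).
  by exists (weight_of v); first exact: packK.
have ubv : ubound A (packing_value x (weight_of v)).
  by move=> _ [w /Kpack[v' Kv' <-] ->]; apply/vmax/mem_set.
have supE : fbs_at x = packing_value x (weight_of v).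
  apply/eqP; rewrite eq_le; apply/andP; split.
    by apply: ge_sup => //; exists (packing_value x (weight_of v)).
  by apply: ub_le_sup => //; exists (packing_value x (weight_of v)).
exists (weight_of v); first exact: packK.
by split=> // w' pw'; rewrite supE; apply: ubv; exists w'.
Qed.

(* The values fbs_at x are nonnegative, so the default 0 of the iterated
   maximum plays no role as soon as S is nonempty. *)
Definition fbs : R := \big[Num.max/0]_x fbs_at x.

End BlockSensitivity.

(* Main.v *)
Require Import Defs.
From mathcomp Require Import all_boot all_order all_algebra.
From mathcomp Require Import all_classical all_reals.
From mathcomp Require Import lra.

Import Order.TTheory GRing.Theory Num.Theory.

Local Open Scope ring_scope.

(** Let w be an optimal fractional packing at x, of value W. Double counting
    gives that the sum of w(B) w(B') over the intersecting pairs (B, B') is at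
    most the sum over i of the squared weight through i, hence at most n.
    On the other hand, among the blocks there are at most bs(f) pairwise
    disjoint ones, so by the Motzkin-Straus inequality, applied to the
    intersection graph with a loop at each block, that sum is at least
    W^2 / bs(f). *)

(** Cauchy-Schwarz for the vectors (sqrt k, 1) and (sqrt q, s). In the greedy induction [s] is the
    weight of the removed neighbourhood, [a] the weight of the rest, and [k] grows by the chosen
    vertex. *)
Lemma sqrD_le_succ (R : realDomainType) (k : nat) (a s q : R) :
  0 <= a -> 0 <= s -> 0 <= q -> a ^+ 2 <= k%:R * q ->
  (a + s) ^+ 2 <= k.+1%:R * (q + s ^+ 2).
Proof.
move=> a0 s0 q0 aq; rewrite -natr1.
set K : R := k%:R in aq *; have K0 : 0 <= K by exact: ler0n.
have Ks0 : 0 <= K * s ^+ 2 by rewrite mulr_ge0 ?sqr_ge0.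
suff : 2 * (a * s) <= q + K * s ^+ 2 by nra.
(* Squaring avoids roots: 4 a^2 s^2 <= 4 q (K s^2) <= (q + K s^2)^2. *)
rewrite -ler_sqr ?nnegrE ?mulr_ge0 ?addr_ge0 //.
have := ler_wpM2r (sqr_ge0 s) aq.
have := sqr_ge0 (q - K * s ^+ 2); nra.
Qed.

(* Greedy choice: adding a vertex x whose neighbourhood N has minimal weight s
   to an independent set of A \ N; every vertex of N then has degree at least
   s, so N contributes at least s^2 to the right-hand side. *)
Lemma motzkin_straus (R : realFieldType) (T : finType) (e : rel T) (p : T -> R)
    (A : {set T}) :
  symmetric e -> {in A, forall x, e x x} -> {in A, forall x, 0 <= p x} ->
  exists2 I : {set T}, I \subset A /\ {in I &, forall x y, x != y -> ~~ e x y} &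
    (\sum_(x in A) p x) ^+ 2 <=
      #|I|%:R * \sum_(x in A) p x * \sum_(y in A | e x y) p y.
Proof.
move=> esym; have [m] := ubnP #|A|; elim: m A => // m IHm A ltAm eA p0.
have [->|[x0 Ax0]] := set_0Vmem A.
  exists finset.set0; last by rewrite !big_set0 expr0n mulr0.
  by split=> [|x y]; rewrite ?sub0set ?inE.
pose d x := \sum_(y in A | e x y) p y.
have [x Ax dmin] : exists2 x, x \in A & {in A, forall y, d x <= d y}.
  by case: (@arg_minP _ R T x0 [in A] d Ax0) => x; exists x.
pose N := [set y in A | e x y].
have sNA : N \subset A by apply/fintype.subsetP => y; rewrite inE => /andP[].
(* The loop at [x] puts [x] in [N], so [A'] is strictly smaller than [A]. *)
have Nx : x \in N by rewrite inE Ax eA.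
pose A' := A :\: N.
have sA'A : A' \subset A by exact: subsetDl.
have [|y /(fintype.subsetP sA'A)/eA //|y /(fintype.subsetP sA'A)/p0 //|I [sIA' indI] IHI] :=
  IHm A'.
  by apply: leq_trans (proper_card _) ltAm; apply/properP; split=> //;
    exists x => //; rewrite finset.in_setD Nx.
have xI y : y \in I -> ~~ e x y.
  by move=> /(fintype.subsetP sIA'); rewrite !inE => /andP[/nandP[/negP|//]].
have nIx : x \notin I by apply/negP => /xI; rewrite eA.
exists (x |: I).
  split; first by rewrite finset.subUset finset.sub1set Ax (fintype.subset_trans sIA').
  move=> y z /setU1P[->|Iy] /setU1P[->|Iz]; rewrite ?eqxx //.
  - by rewrite xI.
  - by rewrite esym xI.
  - exact: indI.
have splitA (F : T -> R) : \sum_(y in A) F y = \sum_(y in A') F y + \sum_(y in N) F y.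
  by rewrite (big_setID N) /= (finset.setIidPr sNA) addrC.
have dN : \sum_(y in N) p y = d x by apply: eq_bigl => y; rewrite inE.
have dx0 : 0 <= d x by apply: sumr_ge0 => y /andP[/p0].
rewrite cardsU1 nIx add1n splitA dN [X in _ * X]splitA.
have pA' y : y \in A' -> 0 <= p y by move/(fintype.subsetP sA'A)/p0.
pose q := \sum_(y in A') p y * \sum_(z in A' | e y z) p z.
apply: (@le_trans _ _ (#|I|.+1%:R * (q + d x ^+ 2))).
  apply: sqrD_le_succ => //; first exact: sumr_ge0.
  apply: sumr_ge0 => y A'y; rewrite mulr_ge0 ?pA' //.
  by apply: sumr_ge0 => z /andP[/pA'].
rewrite ler_wpM2l // lerD //.
  (* Edges from [A'] to [N] are dropped; their terms are nonnegative. *)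
  apply: ler_sum => y A'y; rewrite ler_wpM2l ?pA' //.
  rewrite [leLHS]big_mkcondr [leRHS]big_mkcondr /= splitA lerDl.
  apply: sumr_ge0 => z /(fintype.subsetP sNA) Az.
  by case: ifP; rewrite ?p0.
rewrite expr2 -{1}dN mulr_suml; apply: ler_sum => y /(fintype.subsetP sNA) Ay.
by rewrite ler_wpM2l ?p0 ?dmin.
Qed.

(** The squared load at i, which is at most 1, expands into the products [w B * w C] over blocks
    containing i. Summed over i, each intersecting pair is counted #|B :&: C| >= 1 times. *)
Lemma sum_intersecting_le (R : realFieldType) (n : nat)
    (F : {set {set 'I_n}}) (w : {set 'I_n} -> R) :
  {in F, forall B, 0 <= w B} ->
  (forall i, \sum_(B in F | i \in B) w B <= 1) ->
  \sum_(B in F) w B * \sum_(C in F | ~~ [disjoint B & C]) w C <= n%:R.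
Proof.
move=> w0 w1.
have load0 i : 0 <= \sum_(B in F | i \in B) w B by apply: sumr_ge0 => B /andP[/w0].
apply: (@le_trans _ _ (\sum_(i < n) (\sum_(B in F | i \in B) w B) ^+ 2)); last first.
  rewrite -[leRHS](_ : \sum_(i < n) (1 : R) = _); last by rewrite sumr_const card_ord.
  by apply: ler_sum => i _; rewrite expr_le1.
under [leRHS]eq_bigr do rewrite expr2 mulr_suml big_mkcondr /=.
rewrite exchange_big /=; apply: ler_sum => B FB.
rewrite -big_mkcond /= -mulr_sumr ler_wpM2l ?w0 //.
under [leRHS]eq_bigr do rewrite big_mkcondr /=.
rewrite exchange_big /= big_mkcondr /=; apply: ler_sum => C FC.
case: ifPn => [/pred0Pn[i /andP[Bi Ci]]|_]; last by apply: sumr_ge0 => i _; case: ifP; rewrite ?w0.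
(* A single common index [i] already supplies the product. *)
rewrite (bigD1 i) //= [i \in C]Ci lerDl; apply: sumr_ge0 => j _.
by case: ifP; rewrite ?w0.
Qed.

Theorem theorem4 (R : realType) (G H : finType) (n : nat)
    (S : {set {ffun 'I_n -> G}})
    (f : {x : {ffun 'I_n -> G} | x \in S} -> H) :
  nonconstant f ->
  fbs R f <= Num.sqrt (n%:R * (bs f)%:R).
Proof.
move=> _; rewrite /fbs; apply: bigmax_le => [|x _]; first exact: sqrtr_ge0.
have [w [w01 w1] [<- _]] := fbs_at_max R f x.
rewrite /packing_value; set F := sensitive_blocks f x in w01 w1 *.
have w0 : {in F, forall B, 0 <= w B} by move=> B /w01/andP[].
apply: le_trans (ler_norm _) _; rewrite -sqrtr_sqr ler_wsqrtr //.
have meet_sym : symmetric (fun B C : {set 'I_n} => ~~ [disjoint B & C]).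
  by move=> B C; rewrite disjoint_sym.
(* The loops: an empty block would force y = x, against f y != f x. *)
have F_neq0 : {in F, forall B : {set 'I_n}, ~~ [disjoint B & B]}.
  move=> B; rewrite inE => /existsP[y /andP[fyx /eqP->]].
  rewrite -finset.setI_eq0 finset.setIid; apply: contra fyx => /eqP xy0.
  suff -> : y = x by [].
  apply/val_inj/ffunP => i; apply/eqP; rewrite eq_sym.
  by have := finset.in_set0 i; rewrite -xy0 inE => /negbFE.
have [I [sIF indI] /le_trans-> //] := motzkin_straus _ _ _ _ _ meet_sym F_neq0 w0.
rewrite mulrC ler_pM //.
- apply: sumr_ge0 => B FB; rewrite mulr_ge0 ?w0 //.
  by apply: sumr_ge0 => C /andP[/w0].
- exact: sum_intersecting_le.
(* Independence in the intersection graph is disjointness, so [I] competes in the maximum defining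
   [bs_at]. *)
rewrite ler_nat; apply: leq_trans (leq_bigmax x).
apply: (@leq_bigmax_cond _ _ (fun P : {set {set 'I_n}} => #|P|)).
rewrite sIF; apply/finset.trivIsetP => B C IB IC BC.
by have := indI B C IB IC BC; rewrite negbK.
Qed.
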